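(* Let $S_1,S_2\subset\mathbb{R}^3$ be two real rational ruled surfaces properly parametrized by $\boldsymbol{x}_i(t,s)=\boldsymbol{p}_i(t)+s\,\boldsymbol{q}_i(t)$, $i=1,2$, which are neither doubly ruled nor cylindrical, where $\boldsymbol{q}_i=(q_{i,1},q_{i,2},q_{i,3})$ has polynomial components in $\mathbb{R}[t]$ with $\gcd(q_{i,1},q_{i,2},q_{i,3})=1$, and where $\max_j\deg q_{1,j}=\max_j\deg q_{2,j}=n$. Then the affine equivalences $f(\mathbf{x})=\boldsymbol{A}\mathbf{x}+\boldsymbol{b}$ between $S_1$ and $S_2$ correspond exactly to the $\boldsymbol{A}\in\mathbb{R}^{3\times3}$, $\boldsymbol{b}\in\mathbb{R}^3$ with $\det(\boldsymbol{A})\neq0$ for which there exist a constant $k\neq0$, a Möbius transformation $\psi(t)=\dfrac{\alpha t+\beta}{\gamma t+\delta}$ with $\alpha\delta-\beta\gamma\neq0$, and a rational function $c(t)$ such that $$\boldsymbol{A}\,\boldsymbol{q}_1(t)=k\,(\gamma t+\delta)^{n}\,\boldsymbol{q}_2(\psi(t))$$ and $$\boldsymbol{A}\,\boldsymbol{p}_1(t)+\boldsymbol{b}=\boldsymbol{p}_2(\psi(t))+c(t)\,\boldsymbol{q}_2(\psi(t)).$$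
   Context: Here $\boldsymbol{p}_i$ is a triple of real rational functions of $t$, and $S_i$ is the (irreducible, two-dimensional) real algebraic surface parametrized by $\boldsymbol{x}_i$, i.e. the Zariski closure in $\mathbb{R}^3$ of the image of $\boldsymbol{x}_i$. The parametrization is proper if it is birational as a map $\mathbb{R}^2\dashrightarrow S_i$. The rulings of $S_i$ are the lines $s\mapsto\boldsymbol{x}_i(t,s)$; $S_i$ is doubly ruled if it contains two different families of rulings (this happens exactly for the plane, the hyperbolic paraboloid and the single-sheeted hyperboloid). $S_i$ is cylindrical if all its rulings are parallel (equivalently, under the coprimality assumption, $\boldsymbol{q}_i$ is constant). An affine equivalence between $S_1$ and $S_2$ is a nonsingular affine map $f:\mathbb{R}^3\to\mathbb{R}^3$ with $f(S_1)=S_2$. All coefficients and constants are real; the displayed equalities are identities of rational functions in $t$. *)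

(* Defs.v *)
From HB Require Import structures.
From mathcomp Require Import all_boot all_order all_algebra.
From mathcomp Require Import mpoly.
From mathcomp Require Import boolp classical_sets cardinality reals.

Set Implicit Arguments.
Unset Strict Implicit.
Unset Printing Implicit Defensive.

Import Order.TTheory GRing.Theory Num.Theory.

Local Open Scope classical_set_scope.
Local Open Scope ring_scope.

(* The field R(t). *)
Notation ratfun R := {fraction {poly R}}.

Section RationalFunctions.
Variable R : realType.

Definition poly_ratfun (P : {poly R}) : ratfun R := tofrac P.

Definition const_ratfun (a : R) : ratfun R := poly_ratfun a%:P.

(* [f] is regular at [t] with value [v].  The fraction n/d need not be reduced,
   so removable singularities do belong to the domain of [f]. *)
Definition ratfun_value (f : ratfun R) (t v : R) : Prop :=
  exists n d : {poly R},
    [/\ f = poly_ratfun n / poly_ratfun d, d.[t] != 0 & v = n.[t] / d.[t]].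

Definition poly_comp (P : {poly R}) (g : ratfun R) : ratfun R :=
  (map_poly const_ratfun P).[g].

(* f o g, computed on the chosen representative of [f].  The value does not
   depend on the representative when [g] is nonconstant; only Moebius
   transformations are substituted below. *)
Definition ratfun_comp (f g : ratfun R) : ratfun R :=
  poly_comp \n_(repr f) g / poly_comp \d_(repr f) g.

Definition mobius (alpha beta gamma delta : R) : ratfun R :=
  poly_ratfun (alpha *: 'X + beta%:P) / poly_ratfun (gamma *: 'X + delta%:P).

End RationalFunctions.

Section RuledSurfaces.
Variable R : realType.

Definition poly_vec (q : 'cV[{poly R}]_3) : 'cV[ratfun R]_3 :=
  map_mx (@poly_ratfun R) q.

Definition eval_vec (q : 'cV[{poly R}]_3) (t : R) : 'cV[R]_3 :=
  map_mx (horner^~ t) q.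

Definition eval3 (F : {mpoly R[3]}) (x : 'cV[R]_3) : R :=
  F.@[fun i => x i 0].

Definition zariski_closure (X : set 'cV[R]_3) : set 'cV[R]_3 :=
  [set y | forall F : {mpoly R[3]},
     (forall x, X x -> eval3 F x = 0) -> eval3 F y = 0].

(* The parametrization x(t,s) = p(t) + s q(t), as a partial function: it is
   defined at (t,s) when every component of [p] is regular at [t]. *)
Definition ruled_point (p : 'cV[ratfun R]_3) (q : 'cV[{poly R}]_3)
    (t s : R) (y : 'cV[R]_3) : Prop :=
  exists2 u : 'cV[R]_3,
    (forall j, ratfun_value (p j 0) t (u j 0)) & y = u + s *: eval_vec q t.

Definition ruled_surface (p : 'cV[ratfun R]_3) (q : 'cV[{poly R}]_3) :
    set 'cV[R]_3 :=
  zariski_closure [set y | exists t s, ruled_point p q t s y].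

(* Birationality of x : R^2 --> S: there is a rational map g = (a1/b1, a2/b2)
   from S to R^2, whose denominators do not vanish identically on S, such that
   g o x = id and x o g = id wherever the composites are defined. *)
Definition proper_param (p : 'cV[ratfun R]_3) (q : 'cV[{poly R}]_3) : Prop :=
  exists a1 b1 a2 b2 : {mpoly R[3]},
  [/\ exists2 y, ruled_surface p q y & eval3 b1 y != 0,
      exists2 y, ruled_surface p q y & eval3 b2 y != 0,
      forall t s y, ruled_point p q t s y ->
        eval3 b1 y != 0 -> eval3 b2 y != 0 ->
        eval3 a1 y / eval3 b1 y = t /\ eval3 a2 y / eval3 b2 y = s
    & forall y z, ruled_surface p q y ->
        eval3 b1 y != 0 -> eval3 b2 y != 0 ->
        ruled_point p q (eval3 a1 y / eval3 b1 y) (eval3 a2 y / eval3 b2 y) z ->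
        z = y].

Definition ruling (p : 'cV[ratfun R]_3) (q : 'cV[{poly R}]_3) (t : R) :
    set 'cV[R]_3 :=
  [set y | exists s, ruled_point p q t s y].

Definition rulings (p : 'cV[ratfun R]_3) (q : 'cV[{poly R}]_3) :
    set (set 'cV[R]_3) :=
  [set L | L !=set0 /\ exists t, L = ruling p q t].

Definition family_of_rulings (S : set 'cV[R]_3) (F : set (set 'cV[R]_3)) :
    Prop :=
  exists (p : 'cV[ratfun R]_3) (q : 'cV[{poly R}]_3),
    [/\ proper_param p q, S = ruled_surface p q & F = rulings p q].

(* A family of rulings is the image of the real line in an irreducible
   algebraic curve of lines, up to finitely many missing members (at poles of
   [p] and at t = oo).  Two families are the same exactly when they lie on the
   same curve, i.e. when they share infinitely many lines.  Requiring only
   F <> G as sets of lines would separate Moebius reparametrizations of a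
   single family, since these omit different lines. *)
Definition doubly_ruled (S : set 'cV[R]_3) : Prop :=
  exists F G : set (set 'cV[R]_3),
    [/\ family_of_rulings S F, family_of_rulings S G & finite_set (F `&` G)].

Definition cylindrical (q : 'cV[{poly R}]_3) : Prop :=
  exists v : 'cV[R]_3, forall t, exists l : R, eval_vec q t = l *: v.

Definition coprime_vec (q : 'cV[{poly R}]_3) : bool :=
  \big[@gcdp R/0]_(j < 3) q j 0 %= 1.

(* size P = deg P + 1 for P != 0. *)
Definition degree_vec (q : 'cV[{poly R}]_3) : nat :=
  \max_(j < 3) (size (q j 0%R)).-1.

Definition affine_equivalence (A : 'M[R]_3) (b : 'cV[R]_3)
    (S1 S2 : set 'cV[R]_3) : Prop :=
  \det A != 0 /\ [set A *m x + b | x in S1] = S2.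

Definition const_mat (m k : nat) (M : 'M[R]_(m, k)) : 'M[ratfun R]_(m, k) :=
  map_mx (@const_ratfun R) M.

Definition vec_comp (f : 'cV[ratfun R]_3) (psi : ratfun R) :
    'cV[ratfun R]_3 :=
  map_mx (fun h => ratfun_comp h psi) f.

End RuledSurfaces.

(* Main.v *)
(* Idea.  An affine equivalence turns (p1, q1) into a second proper ruled
   parametrization (A p1 + b, A q1) of S2.  As S2 is not doubly ruled, it shares
   infinitely many rulings with (p2, q2).  The inverse of x_2, restricted to a
   curve [s = s0] of the other parametrization, is a rational function of t that
   gives the parameter of each shared ruling; the symmetric construction inverts
   it, so a degree count makes it a Moebius transformation psi.  The directions
   and base points then match along infinitely many rulings, hence identically,
   and coprimality and the common degree n make the factor k constant.
   Conversely, the two equations say that all but finitely many rulings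
   correspond, and these are Zariski dense. *)
Require Import Defs.
From HB Require Import structures.
From mathcomp Require Import all_boot all_order all_algebra.
From mathcomp Require Import mpoly ring.
From mathcomp Require Import boolp classical_sets functions cardinality reals.

Set Implicit Arguments.
Unset Strict Implicit.
Unset Printing Implicit Defensive.

Import Order.TTheory GRing.Theory Num.Theory.

Local Open Scope ring_scope.

(** * Polynomials determined by their values on an infinite set *)

Section PolynomialIdentities.
Local Open Scope classical_set_scope.

Lemma finite_roots (R : idomainType) (p : {poly R}) :
  p != 0 -> finite_set [set t | p.[t] = 0].
Proof.
elim: {p}_.+1 {-2}p (ltnSn (size p)) => // m IHm p lepm p0.
have [[a /= pa0]|nor] := pselect (exists a, p.[a] = 0); last first.
  by apply: (sub_finite_set _ (finite_set0 R)) => t /= pt; apply: nor; exists t.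
have /factor_theorem[q pE] : root p a by apply/rootP.
have q0 : q != 0 by apply: contraNneq p0 => q0; rewrite pE q0 mul0r.
have finq : finite_set [set t | q.[t] = 0].
  apply: IHm => //; move: lepm.
  by rewrite pE size_Mmonic ?monicXsubC// size_XsubC addn2.
apply: (@sub_finite_set _ _ ([set t | q.[t] = 0] `|` [set a])); last first.
  by rewrite finite_setU.
move=> t /= /eqP; rewrite pE hornerM hornerXsubC mulf_eq0 subr_eq0.
by move=> /orP[/eqP|/eqP]; [left|right].
Qed.

Lemma poly_eq_infinite (R : idomainType) (T : set R) (p q : {poly R}) :
  infinite_set T -> (forall t, T t -> p.[t] = q.[t]) -> p = q.
Proof.
move=> infT pq; apply/eqP; rewrite -subr_eq0; apply/contra_notT: infT => pq0.
apply: sub_finite_set (finite_roots pq0) => t Tt /=.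
by rewrite hornerD hornerN pq// subrr.
Qed.

(** Characteristic zero: the natural numbers embed. *)
Lemma infinite_numField (R : numFieldType) : infinite_set [set: R].
Proof.
move=> fin; apply: infinite_nat.
rewrite -(preimage_setT (GRing.natmul 1 : nat -> R)); apply: finite_preimage fin.
by move=> m n _ _ /eqP; rewrite eqr_nat => /eqP.
Qed.

End PolynomialIdentities.

(** * Rational functions with a rational inverse are Möbius transformations *)

Section Homogenization.
Variable F : fieldType.
Implicit Types U V N D : {poly F}.

(* The degree-[m] homogenization of [U] evaluated at the pair [(N, D)], that is
   [D ^ m * U (N / D)] when [deg U <= m]. *)
Definition homogenize (m : nat) U N D : {poly F} :=
  \sum_(i < m.+1) U`_i *: (N ^+ i * D ^+ (m - i)).

Lemma horner_homogenize m U N D t :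
  (homogenize m U N D).[t] =
    \sum_(i < m.+1) U`_i * (N.[t] ^+ i * D.[t] ^+ (m - i)).
Proof.
rewrite horner_sum; apply: eq_bigr => i _.
by rewrite hornerZ hornerM !horner_exp.
Qed.

Lemma horner_homogenize_div m U N D t : (size U <= m.+1)%N -> D.[t] != 0 ->
  (homogenize m U N D).[t] = D.[t] ^+ m * U.[N.[t] / D.[t]].
Proof.
move=> leUm D0; rewrite horner_homogenize (horner_coef_wide _ leUm) mulr_sumr.
apply: eq_bigr => i _; rewrite expr_div_n [RHS]mulrCA; congr (_ * _).
have -> : D.[t] ^+ m = D.[t] ^+ (m - i) * D.[t] ^+ i.
  by rewrite -exprD subnK// -ltnS.
by rewrite -mulrA [_ * (_ / _)]mulrCA divff ?mulr1 1?mulrC// expf_neq0.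
Qed.

(** [a] and [b] only bound the degrees: every other term of the convolution has a factor beyond its
    bound. A top coefficient may be zero. *)
Lemma coefM_top (p q : {poly F}) a b :
  (size p <= a.+1)%N -> (size q <= b.+1)%N -> (p * q)`_(a + b) = p`_a * q`_b.
Proof.
move=> pa qb; rewrite coefM.
have lt : (a < (a + b).+1)%N by rewrite ltnS leq_addr.
rewrite (bigD1 (Ordinal lt)) //= addKn big1 ?addr0// => i.
rewrite -val_eqE /= neq_ltn => /orP[ia|ai].
  rewrite [q`_ _]nth_default ?mulr0//; apply: leq_trans qb _.
  by rewrite -addnBAC ?(ltnW ia)// -addn1 addnC leq_add2r subn_gt0.
by rewrite nth_default ?mul0r//; apply: leq_trans ai.
Qed.

Lemma size_exp_bound (p : {poly F}) d i : (size p <= d.+1)%N ->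
  (size (p ^+ i) <= (d * i).+1)%N.
Proof.
move=> pd; apply: leq_trans (size_poly_exp_leq p i) _.
by rewrite ltnS leq_mul2r -subn1 leq_subLR add1n pd orbT.
Qed.

Lemma coefX_top (p : {poly F}) d i : (size p <= d.+1)%N ->
  (p ^+ i)`_(d * i) = p`_d ^+ i.
Proof.
move=> pd; elim: i => [|i IHi]; first by rewrite muln0 !expr0 coef1.
by rewrite !exprS mulnS coefM_top ?IHi// size_exp_bound.
Qed.

Lemma size_homogenize m U N D d :
  (size N <= d.+1)%N -> (size D <= d.+1)%N ->
  (size (homogenize m U N D) <= (d * m).+1)%N.
Proof.
move=> Nd Dd; rewrite /homogenize.
apply: leq_trans (size_sum _ _ _) _; apply/bigmax_leqP => i _.
apply: leq_trans (size_scale_leq _ _) _; apply: leq_trans (size_polyMleq _ _) _.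
have := leq_add (size_exp_bound i Nd) (size_exp_bound (m - i) Dd).
by rewrite addSn addnS -mulnDr subnKC -1?ltnS// -subn1 leq_subLR add1n.
Qed.

Lemma coef_homogenize_top m U N D d :
  (size N <= d.+1)%N -> (size D <= d.+1)%N ->
  (homogenize m U N D)`_(d * m) =
    \sum_(i < m.+1) U`_i * (N`_d ^+ i * D`_d ^+ (m - i)).
Proof.
move=> Nd Dd; rewrite coef_sum; apply: eq_bigr => i _; rewrite coefZ.
have -> : (d * m = d * i + d * (m - i))%N by rewrite -mulnDr subnKC// -ltnS.
by rewrite coefM_top ?coefX_top// size_exp_bound.
Qed.

(** Each term with $i<m$ carries a factor [D], so modulo [g] only the top term is left. *)
Lemma dvdp_homogenize m U N D (g : {poly F}) : g %| D ->
  (g %| homogenize m U N D) = (g %| U`_m *: N ^+ m).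
Proof.
move=> gD; rewrite /homogenize big_ord_recr /= subnn expr0 mulr1 dvdp_addr//.
rewrite (big_ind (fun p => g %| p)) ?dvdp0//.
  by move=> p q gp gq; rewrite dvdp_add.
move=> [i /= im] _; rewrite -mul_polyC dvdp_mull// dvdp_mull//.
by rewrite -(subnSK im) exprS dvdp_mulr.
Qed.

Lemma size_pred_max (p q : {poly F}) :
  (size p <= (maxn (size p) (size q)).-1.+1)%N /\
  (size q <= (maxn (size p) (size q)).-1.+1)%N.
Proof. by rewrite !(leq_trans _ (leqSpred _)) ?leq_maxl ?leq_maxr. Qed.

(** The larger of the two degrees is attained. With both polynomials zero the predecessor would
    truncate to 0, where both coefficients vanish. *)
Lemma coef_pred_max_neq0 (p q : {poly F}) : q != 0 ->
  let d := (maxn (size p) (size q)).-1 in p`_d != 0 \/ q`_d != 0.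
Proof.
move=> q0 d; rewrite /d; case: leqP => pq; [right|left].
  by rewrite -lead_coefE lead_coef_eq0.
by rewrite -lead_coefE lead_coef_eq0 -size_poly_gt0 (leq_trans _ pq).
Qed.

(* Homogenizing [U (N / D) = t V (N / D)] gives [Uh = 'X * Vh] for two coprime
   polynomials, so [Vh] is constant and [Uh] is linear; but
   [max (deg Uh) (deg Vh) = max (deg U) (deg V) * max (deg N) (deg D)]. *)
Lemma birational_degree_le1 (T : set F) N D U V :
  infinite_set T -> coprimep N D -> coprimep U V ->
  (forall t, T t -> [/\ D.[t] != 0, V.[N.[t] / D.[t]] != 0 &
     U.[N.[t] / D.[t]] / V.[N.[t] / D.[t]] = t]) ->
  (size N <= 2)%N /\ (size D <= 2)%N.
Proof.
move=> infT cND cUV invT.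
have [t0 Tt0] := infinite_setN0 infT.
have D0 : D != 0.
  by apply/eqP => E0; have [] := invT _ Tt0; rewrite E0 horner0 eqxx.
have V0 : V != 0.
  by apply/eqP => E0; have [] := invT _ Tt0; rewrite E0 horner0 eqxx.
pose m := (maxn (size U) (size V)).-1.
have [sU sV] := size_pred_max U V; rewrite -/m in sU sV.
have top : U`_m != 0 \/ V`_m != 0 by apply: coef_pred_max_neq0.
pose UH := homogenize m U N D; pose VH := homogenize m V N D.
have UHE : UH = 'X * VH.
  apply: (poly_eq_infinite infT) => t /invT[Dt Vt UVt].
  rewrite hornerM hornerX !horner_homogenize_div//.
  by rewrite (canRL (divfK Vt) UVt) mulrCA.
(* A common divisor of [VH] and [D] also divides [UH], hence both $U_mN^m$ and $V_mN^m$. One of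
   these scalars is nonzero, so it divides $N^m$, which is coprime to [D]. *)
have coVD : coprimep VH D.
  apply/coprimepP => g gV gD; have gU : g %| UH by rewrite UHE dvdp_mull.
  have gN : g %| N ^+ m.
    move: gU gV; rewrite !dvdp_homogenize//.
    by case: top => c0; rewrite ?(dvdpZr _ _ c0)// => _; rewrite dvdpZr.
  have : coprimep g g.
    apply: coprimep_dvdl gN _; apply: coprimep_expr.
    by apply: coprimep_dvdr gD _; rewrite coprimep_sym.
  by rewrite coprimepp size_poly_eq1.
have [[u v] /= uv1] := Bezout_eq1_coprimepP _ _ cUV.
pose e := (maxn (size u) (size v)).-1.
have [su sv] := size_pred_max u v; rewrite -/e in su sv.
(* The Bezout relation $uU+vV=1$ at $N/D$, cleared of denominators: a common divisor of [UH] and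
   [VH] divides a power of [D]. *)
have DE : homogenize e u N D * UH + homogenize e v N D * VH = D ^+ (e + m).
  apply: (poly_eq_infinite infT) => t /invT[Dt _ _].
  rewrite hornerD !hornerM !horner_homogenize_div// horner_exp exprD.
  rewrite -[RHS]mulr1 -(hornerC 1 (N.[t] / D.[t])) -[1%:P]uv1 hornerD !hornerM.
  by ring.
(* As [UH] is a multiple of [VH], the latter divides a power of [D], to which it is coprime; hence
   it is a unit. *)
have sVH : size VH = 1%N.
  apply/eqP; rewrite -coprimepp.
  apply: (coprimep_dvdl _ (coprimep_expr (e + m) coVD)).
  by rewrite -DE UHE dvdp_add ?dvdp_mull.
have VH0 : VH != 0 by rewrite -size_poly_gt0 sVH.
have sUH : size UH = 2%N by rewrite UHE mulrC size_mulX// sVH.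
pose d := (maxn (size N) (size D)).-1.
have [sN sD] := size_pred_max N D; rewrite -/d in sN sD.
suff led1 : (d <= 1)%N by rewrite (leq_trans sN)// (leq_trans sD).
rewrite leqNgt; apply/negP => d2.
have m0 : (0 < m)%N.
  rewrite lt0n; apply: contra_eqN sUH => /eqP m0.
  by have := size_homogenize m U sN sD; rewrite -/UH m0 muln0; case: (size UH) => [|[]].
(* Now $dm$ exceeds the degrees of [UH] and [VH], so the homogeneous forms of [U] and [V] both
   vanish at the projective point $(N_d:D_d)$. *)
have dm : (2 <= d * m)%N by rewrite (leq_trans d2)// leq_pmulr.
have := coef_homogenize_top m U sN sD; have := coef_homogenize_top m V sN sD.
have -> : (homogenize m U N D)`_(d * m) = 0 by rewrite nth_default// sUH.
have -> : (homogenize m V N D)`_(d * m) = 0 by rewrite nth_default// sVH ltnW.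
(* A zero at infinity would kill both coefficients of index [m]; a zero at a finite point would be a
   common root of [U] and [V]. *)
have [b0|b0] := eqVneq D`_d 0.
  have a0 : N`_d != 0.
    have := coef_pred_max_neq0 N D0; rewrite -/d /= b0 eqxx.
    by case.
  have topE (W : {poly F}) : \sum_(i < m.+1) W`_i * (N`_d ^+ i * D`_d ^+ (m - i)) =
      W`_m * N`_d ^+ m.
    rewrite big_ord_recr /= subnn expr0 mulr1 big1 ?add0r// => i _.
    by rewrite b0 expr0n subn_eq0 leqNgt ltn_ord /= !mulr0.
  rewrite !topE => /esym/eqP + /esym/eqP.
  rewrite !mulf_eq0 !expf_eq0 (negPf a0) !andbF !orbF => /eqP v0 /eqP u0.
  by move: top; rewrite v0 u0 eqxx; case.
have formE (W : {poly F}) : (size W <= m.+1)%N ->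
    \sum_(i < m.+1) W`_i * (N`_d ^+ i * D`_d ^+ (m - i)) =
    D`_d ^+ m * W.[N`_d / D`_d].
  (* Constant polynomials turn the polynomial identity into one between numbers; the evaluation
     point 0 is arbitrary. *)
  move=> sW; have := @horner_homogenize_div m W (N`_d)%:P (D`_d)%:P 0 sW.
  by rewrite horner_homogenize !hornerC => ->.
rewrite !formE// => /esym/eqP + /esym/eqP.
rewrite !mulf_eq0 !expf_eq0 (negPf b0) !andbF /= => Vr /(coprimep_root cUV).
by rewrite Vr.
Qed.

(** Reduction to lowest terms keeps all values on [T], and then the degree bound leaves a quotient
    of linear polynomials. *)
Lemma birational_mobius (T : set F) N D U V :
  infinite_set T ->
  (forall t, T t -> [/\ D.[t] != 0, V.[N.[t] / D.[t]] != 0 &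
     U.[N.[t] / D.[t]] / V.[N.[t] / D.[t]] = t]) ->
  exists a b c d : F, a * d - b * c != 0 /\
    forall t, T t -> c * t + d != 0 /\ N.[t] / D.[t] = (a * t + b) / (c * t + d).
Proof.
move=> infT invT.
have [t0 Tt0] := infinite_setN0 infT.
have reduce (P Q : {poly F}) : Q != 0 -> exists P' Q' : {poly F},
    coprimep P' Q' /\ forall t, Q.[t] != 0 ->
      Q'.[t] != 0 /\ P.[t] / Q.[t] = P'.[t] / Q'.[t].
  move=> Q0; exists (P %/ gcdp P Q), (Q %/ gcdp P Q); split.
    by rewrite coprimep_div_gcd// Q0 orbT.
  move=> t; have PE := divpK (dvdp_gcdl P Q); have QE := divpK (dvdp_gcdr P Q).
  rewrite -{1 4}QE -{4}PE !hornerM mulf_eq0 negb_or => /andP[Q't g0]; split=> //.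
  by rewrite -mulf_div divff// mulr1.
have D0 : D != 0.
  by apply/eqP => E0; have [] := invT _ Tt0; rewrite E0 horner0 eqxx.
have V0 : V != 0.
  by apply/eqP => E0; have [] := invT _ Tt0; rewrite E0 horner0 eqxx.
have [N' [D' [cND ND]]] := reduce N D D0.
have [U' [V' [cUV UV]]] := reduce U V V0.
have invT' t : T t -> [/\ D'.[t] != 0, V'.[N'.[t] / D'.[t]] != 0 &
     U'.[N'.[t] / D'.[t]] / V'.[N'.[t] / D'.[t]] = t].
  move=> /invT[/ND[D't NDE]]; rewrite NDE => /UV[V't UVE]; rewrite UVE.
  by split.
have [sN sD] := birational_degree_le1 infT cND cUV invT'.
exists N'`_1, N'`_0, D'`_1, D'`_0.
have lin (W : {poly F}) t : (size W <= 2)%N -> W.[t] = W`_1 * t + W`_0.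
  move=> sW; rewrite (horner_coef_wide _ sW) big_ord_recl big_ord1 /=.
  by rewrite expr0 expr1 mulr1 addrC.
split; last first.
  move=> t Tt; have [D't _ _] := invT' t Tt; have [/ND[_ ->] _ _] := invT t Tt.
  by rewrite -!lin.
(* With zero determinant $N'/D'$ is constant on [T]; since $U'/V'$ recovers [t] from it, [T] would
   be a single point. *)
apply/eqP => det0; apply: infT.
apply: (@sub_finite_set _ _ [set t0]) => // t Tt /=.
have [D't _ <-] := invT' t Tt; have [D't0 _ <-] := invT' t0 Tt0.
suff -> : N'.[t] / D'.[t] = N'.[t0] / D'.[t0] by [].
apply/eqP; rewrite eqr_div// -subr_eq0 !lin//; apply/eqP.
transitivity ((t - t0) * (N'`_1 * D'`_0 - N'`_0 * D'`_1)); first ring.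
by rewrite det0 mulr0.
Qed.

End Homogenization.

(** * Values and composition of rational functions *)

Lemma fraction_reprE (K : idomainType) (f : {fraction K}) :
  f = tofrac \n_(repr f) / tofrac \d_(repr f).
Proof.
rewrite -{1}[f]reprK; case: (repr f) => [[n d] /= d0].
rewrite !piE; apply/eqmodP => /=.
rewrite /FracField.equivf /FracField.mulf /FracField.invf /=.
by rewrite !numden_Ratio ?mulr1 ?mul1r ?oner_neq0//= mulrC.
Qed.

Section RationalFunctionValues.
Variable R : realType.
Local Open Scope classical_set_scope.
Implicit Types (f g : ratfun R) (P Q n d : {poly R}) (t v w : R).

Lemma ratfun_frac f : exists n d, d != 0 /\ f = poly_ratfun n / poly_ratfun d.
Proof.
exists \n_(repr f), \d_(repr f); split; first exact: denom_ratioP.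
exact: fraction_reprE.
Qed.

Lemma horner_neq0 d t : d.[t] != 0 -> d != 0.
Proof. by apply: contraNneq => ->; rewrite horner0. Qed.

Lemma poly_ratfun_eq0 P : (poly_ratfun P == 0) = (P == 0).
Proof. exact: tofrac_eq0. Qed.

Lemma ratfun_value_frac n d t : d.[t] != 0 ->
  ratfun_value (poly_ratfun n / poly_ratfun d) t (n.[t] / d.[t]).
Proof. by move=> dt; exists n, d. Qed.

Lemma ratfun_value_poly P t : ratfun_value (poly_ratfun P) t P.[t].
Proof.
by exists P, 1; rewrite hornerC oner_neq0; split; rewrite ?divr1.
Qed.

Lemma ratfun_value_const (a : R) t : ratfun_value (const_ratfun a) t a.
Proof. by have := ratfun_value_poly a%:P t; rewrite hornerC. Qed.

Lemma ratfun_valueD f g t v w :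
  ratfun_value f t v -> ratfun_value g t w -> ratfun_value (f + g) t (v + w).
Proof.
move=> [n [d [-> dt ->]]] [n' [d' [-> d't ->]]].
have [d0 d'0] := (horner_neq0 dt, horner_neq0 d't).
exists (n * d' + n' * d), (d * d'); rewrite !hornerE mulf_neq0//; split=> //.
  by rewrite addf_div ?poly_ratfun_eq0// /poly_ratfun tofracD !tofracM.
by rewrite addf_div.
Qed.

Lemma ratfun_valueM f g t v w :
  ratfun_value f t v -> ratfun_value g t w -> ratfun_value (f * g) t (v * w).
Proof.
move=> [n [d [-> dt ->]]] [n' [d' [-> d't ->]]].
exists (n * n'), (d * d'); rewrite !hornerM mulf_neq0//; split=> //.
  by rewrite mulf_div /poly_ratfun !tofracM.
by rewrite mulf_div.
Qed.

Lemma ratfun_valueV f t v : v != 0 ->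
  ratfun_value f t v -> ratfun_value f^-1 t v^-1.
Proof.
move=> v0 [n [d [-> dt vE]]]; exists d, n; rewrite vE !invf_div; split=> //.
by apply: contraNneq v0 => nt0; rewrite vE nt0 mul0r.
Qed.

Lemma ratfun_value_div f g t v w : w != 0 ->
  ratfun_value f t v -> ratfun_value g t w -> ratfun_value (f / g) t (v / w).
Proof. by move=> w0 fv gw; apply: ratfun_valueM fv _; apply: ratfun_valueV. Qed.

Lemma ratfun_valueN f t v : ratfun_value f t v -> ratfun_value (- f) t (- v).
Proof.
move=> [n [d [-> dt ->]]]; exists (- n), d; rewrite hornerN mulNr; split=> //.
by rewrite /poly_ratfun tofracN mulNr.
Qed.

Lemma ratfun_valueB f g t v w :
  ratfun_value f t v -> ratfun_value g t w -> ratfun_value (f - g) t (v - w).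
Proof. by move=> fv gw; apply: ratfun_valueD => //; apply: ratfun_valueN. Qed.

Lemma ratfun_valueX f t v k :
  ratfun_value f t v -> ratfun_value (f ^+ k) t (v ^+ k).
Proof.
move=> fv; elim: k => [|k IHk]; first exact: (ratfun_value_const 1 t).
by rewrite !exprS; apply: ratfun_valueM.
Qed.

Lemma ratfun_value_sum (I : finType) (f : I -> ratfun R) (v : I -> R) t :
  (forall i, ratfun_value (f i) t (v i)) ->
  ratfun_value (\sum_i f i) t (\sum_i v i).
Proof.
move=> fv; apply: (big_ind2 (fun f v => ratfun_value f t v)) => //.
  exact: (ratfun_value_const 0 t).
by move=> *; apply: ratfun_valueD.
Qed.

(** [d] may vanish at [t]. A representative $n'/d'$ regular at [t] gives $nd'=n'd$, where the right
    side is zero at [t] and $d'(t)\neq0$. *)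
Lemma ratfun_value_eq0 f t v n d : d != 0 -> f = poly_ratfun n / poly_ratfun d ->
  ratfun_value f t v -> v = 0 -> n.[t] = 0.
Proof.
move=> d0 -> [n' [d' [fE d't ->]]] /eqP.
rewrite mulf_eq0 invr_eq0 (negPf d't) orbF => /eqP n't.
move/eqP: fE; rewrite eqr_div ?poly_ratfun_eq0 ?(horner_neq0 d't)//.
rewrite /poly_ratfun -!tofracM tofrac_eq => /eqP/(congr1 (horner^~ t)).
rewrite /= !hornerM n't mul0r => /eqP.
by rewrite mulf_eq0 (negPf d't) orbF => /eqP.
Qed.

Lemma ratfun_value_uniq f t v w :
  ratfun_value f t v -> ratfun_value f t w -> v = w.
Proof.
move=> [n [d [fE dt ->]]] fw.
have gE : f - const_ratfun w = poly_ratfun (n - w *: d) / poly_ratfun d.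
  have d0 : poly_ratfun d != 0 by rewrite poly_ratfun_eq0 (horner_neq0 dt).
  rewrite fE /poly_ratfun tofracB mulrBl -mul_polyC tofracM.
  by congr (_ - _); rewrite mulfK.
have := ratfun_value_eq0 (horner_neq0 dt) gE
  (ratfun_valueB fw (ratfun_value_const w t)) (subrr w).
rewrite hornerD hornerN hornerZ => /eqP; rewrite subr_eq0 => /eqP ->.
by rewrite mulfK.
Qed.

(** The numerator of $f-g$ has infinitely many roots. This turns matching values along infinitely
    many rulings into identities in $\mathbb{R}(t)$. *)
Lemma ratfun_eq_infinite (T : set R) f g : infinite_set T ->
  (forall t, T t -> exists v, ratfun_value f t v /\ ratfun_value g t v) -> f = g.
Proof.
move=> infT fg; apply/eqP; rewrite -subr_eq0.
have [n [d [d0 fgE]]] := ratfun_frac (f - g).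
have n0 : n = 0.
  apply: (poly_eq_infinite infT) => t /fg[v [fv gv]]; rewrite horner0.
  exact: ratfun_value_eq0 d0 fgE (ratfun_valueB fv gv) (subrr v).
by rewrite fgE n0 /poly_ratfun tofrac0 mul0r.
Qed.

Lemma poly_comp_value P g t w :
  ratfun_value g t w -> ratfun_value (poly_comp P g) t P.[w].
Proof.
move=> gw; rewrite /poly_comp /map_poly horner_poly horner_coef.
apply: ratfun_value_sum => i; apply: ratfun_valueM; last exact: ratfun_valueX.
exact: ratfun_value_const.
Qed.

Lemma poly_compM P Q g : poly_comp (P * Q) g = poly_comp P g * poly_comp Q g.
Proof.
(* A bundled form of [const_ratfun], to which the morphism lemmas apply. *)
pose h : {rmorphism R -> ratfun R} := @tofrac _ \o polyC.
by rewrite -[LHS]/((map_poly h (P * Q)).[g]) rmorphM hornerM.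
Qed.

(** The hypothesis on [g] says that it is transcendental over the constants. The composite is then
    independent of the representative, so one regular at [w] may replace [repr f]. *)
Lemma ratfun_comp_value f g t v w :
  (forall P, P != 0 -> poly_comp P g != 0) ->
  ratfun_value f w v -> ratfun_value g t w -> ratfun_value (ratfun_comp f g) t v.
Proof.
move=> gtr [n [d [fE dw ->]]] gw.
have cross : n * \d_(repr f) = \n_(repr f) * d.
  apply/eqP; rewrite -(tofrac_eq (n * _)) !tofracM -eqr_div ?tofrac_eq0//.
  - by rewrite -fraction_reprE; apply/eqP.
  - exact: horner_neq0 dw.
  - exact: denom_ratioP.
have -> : ratfun_comp f g = poly_comp n g / poly_comp d g.
  apply/eqP; rewrite eqr_div ?gtr ?denom_ratioP ?(horner_neq0 dw)//.
  by rewrite -!poly_compM cross.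
by apply: ratfun_value_div => //; apply: poly_comp_value.
Qed.

Section Moebius.
Variables (alpha beta gamma delta : R).
Hypothesis det0 : alpha * delta - beta * gamma != 0.
Let psi t := (alpha * t + beta) / (gamma * t + delta).

Lemma mobius_value t : gamma * t + delta != 0 ->
  ratfun_value (mobius alpha beta gamma delta) t (psi t).
Proof.
move=> t0; have := @ratfun_value_frac (alpha *: 'X + beta%:P)
  (gamma *: 'X + delta%:P) t.
by rewrite !hornerE => /(_ t0).
Qed.

Lemma linear_poly_neq0 : gamma *: 'X + delta%:P != 0 :> {poly R}.
Proof.
apply: contra_neq det0 => E.
have := congr1 (fun P : {poly R} => P`_0) E.
have := congr1 (fun P : {poly R} => P`_1) E.
by rewrite !coefE /= mulr1 mulr0 addr0 add0r => -> ->; rewrite !mulr0 subrr.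
Qed.

(** The denominator $\alpha-\gamma\psi(t)$ equals $(\alpha\delta-\beta\gamma)/(\gamma t+\delta)$,
    hence is nonzero. *)
Lemma mobiusK t : gamma * t + delta != 0 ->
  (delta * psi t - beta) / (alpha - gamma * psi t) = t.
Proof.
move=> t0; have E : alpha - gamma * psi t =
    (alpha * delta - beta * gamma) / (gamma * t + delta).
  by rewrite /psi; field.
rewrite E; have E0 : (alpha * delta - beta * gamma) / (gamma * t + delta) != 0.
  by rewrite mulf_neq0 ?invr_eq0.
by apply: (canLR (mulfK E0)); rewrite /psi; field.
Qed.

Lemma mobius_invK w : alpha - gamma * w != 0 ->
  let t := (delta * w - beta) / (alpha - gamma * w) in
  gamma * t + delta != 0 /\ psi t = w.
Proof.
move=> w0 t; have E : gamma * t + delta =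
    (alpha * delta - beta * gamma) / (alpha - gamma * w).
  by rewrite /t; field.
have E0 : (alpha * delta - beta * gamma) / (alpha - gamma * w) != 0.
  by rewrite mulf_neq0 ?invr_eq0.
rewrite /psi E; split=> //; apply: (canLR (mulfK E0)).
by rewrite /t; field.
Qed.

Lemma finite_linear_roots : finite_set [set t | gamma * t + delta = 0].
Proof.
apply: sub_finite_set (finite_roots linear_poly_neq0) => t /= t0.
by rewrite !hornerE.
Qed.

(** If $P\circ\psi=0$, every [t] off the pole is the preimage of one of the finitely many roots of
    [P]. *)
Lemma poly_comp_mobius_neq0 P : P != 0 ->
  poly_comp P (mobius alpha beta gamma delta) != 0.
Proof.
move=> P0; apply/eqP => E.
apply: (infinite_setD (@infinite_numField R) finite_linear_roots).
apply: (@sub_finite_set _ _ ((fun w => (delta * w - beta) / (alpha - gamma * w))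
  @` [set w | P.[w] = 0])); last exact/finite_image/finite_roots.
move=> t [_ /= /eqP t0]; exists (psi t); last exact: mobiusK.
apply: ratfun_value_uniq (poly_comp_value P (mobius_value t0)) _.
by rewrite E; apply: (ratfun_value_const 0).
Qed.

Lemma mobius_comp_value f t v : gamma * t + delta != 0 ->
  ratfun_value f (psi t) v ->
  ratfun_value (ratfun_comp f (mobius alpha beta gamma delta)) t v.
Proof.
move=> t0 fv; apply: ratfun_comp_value fv (mobius_value t0).
exact: poly_comp_mobius_neq0.
Qed.

End Moebius.

End RationalFunctionValues.

(** * Ruled parametrizations, Zariski density and shared rulings *)

Section RuledParametrizations.
Variable R : realType.
Local Open Scope classical_set_scope.
Implicit Types (p : 'cV[ratfun R]_3) (q : 'cV[{poly R}]_3) (F : {mpoly R[3]}).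
Implicit Types (t s : R) (x y : 'cV[R]_3) (E : set R).

Definition frac_vec (m : 'cV[{poly R}]_3) (d : {poly R}) : 'cV[ratfun R]_3 :=
  \col_j (poly_ratfun (m j 0) / poly_ratfun d).

Lemma common_denominator p (n d : 'I_3 -> {poly R}) :
  (forall j, d j != 0) ->
  (forall j, p j 0 = poly_ratfun (n j) / poly_ratfun (d j)) ->
  exists m, p = frac_vec m (\prod_j d j).
Proof.
move=> d0 pE; exists (\col_j (n j * \prod_(i | i != j) d i)).
apply/matrixP => j k; rewrite !mxE ord1 pE; apply/eqP.
have prod0 : \prod_j d j != 0 by apply/prodf_neq0.
rewrite eqr_div ?poly_ratfun_eq0// /poly_ratfun -!tofracM tofrac_eq.
by apply/eqP; rewrite [in LHS](bigD1 j)//= -mulrA [_ * d j]mulrC.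
Qed.

(** The denominators come from representatives regular at [t], so their product is nonzero there
    too. *)
Lemma frac_vec_regular_at p t (u : 'cV[R]_3) :
  (forall j, ratfun_value (p j 0) t (u j 0)) ->
  exists m d, d.[t] != 0 /\ p = frac_vec m d.
Proof.
move=> /choice[n /choice[d H]].
have [m pE] : exists m, p = frac_vec m (\prod_j d j).
  apply: (common_denominator (n := n)) => j; have [pjE dt _] := H j => //.
  exact: horner_neq0 dt.
exists m, (\prod_j d j); split=> //; rewrite horner_prod; apply/prodf_neq0 => j _.
by have [] := H j.
Qed.

Lemma frac_vecP p : exists m d, d != 0 /\ p = frac_vec m d.
Proof.
have /choice[n /choice[d H]] : forall j, exists n d,
    d != 0 /\ p j 0 = poly_ratfun n / poly_ratfun d.
  by move=> j; apply: ratfun_frac.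
have [m pE] : exists m, p = frac_vec m (\prod_j d j).
  by apply: (common_denominator (n := n)) => j; have [] := H j.
exists m, (\prod_j d j); split=> //; apply/prodf_neq0 => j _.
by have [] := H j.
Qed.

Lemma frac_vec_value m (d : {poly R}) t j : d.[t] != 0 ->
  ratfun_value (frac_vec m d j 0) t ((d.[t]^-1 *: eval_vec m t) j 0).
Proof.
by move=> dt; rewrite !mxE [_^-1 * _]mulrC; apply: ratfun_value_frac.
Qed.

Lemma ruled_point_frac m (d : {poly R}) q t s y : d.[t] != 0 ->
  ruled_point (frac_vec m d) q t s y <->
  y = d.[t]^-1 *: eval_vec m t + s *: eval_vec q t.
Proof.
move=> dt; split=> [[u uv ->]|->].
  congr (_ + _); apply/matrixP => j k; rewrite ord1.
  exact: ratfun_value_uniq (uv j) (frac_vec_value m j dt).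
by exists (d.[t]^-1 *: eval_vec m t) => // j; apply: frac_vec_value.
Qed.

(** Induction on the terms of [F]: a monomial of total degree [ek] contributes the denominator
    $d^{ek}$, and the sum is taken over the product of the powers. *)
Lemma eval3_frac F m (d : {poly R}) : exists (n : {poly R}) (e : nat),
  forall t, d.[t] != 0 ->
    eval3 F (d.[t]^-1 *: eval_vec m t) = n.[t] / d.[t] ^+ e.
Proof.
elim/mpolyind: F => [|c k G _ _ [n [e nE]]].
  by exists 0, 0%N => t _; rewrite /eval3 meval0 horner0 mul0r.
pose ek := (\sum_j k j)%N.
exists (c *: (\prod_j m j 0 ^+ k j) * d ^+ e + n * d ^+ ek), (ek + e)%N => t dt.
rewrite /eval3 mevalD mevalZ mevalX -!/(eval3 _ _) -/(eval3 G _) nE// exprD.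
rewrite !(hornerE, horner_prod, horner_exp) mulrDl.
have de i : d.[t] ^+ i != 0 by rewrite expf_neq0.
congr (_ + _).
  rewrite -mulf_div divff ?mulr1//.
  rewrite -mulrA; congr (c * _).
  rewrite /ek -prodrXr -prodfV -big_split /=; apply: eq_bigr => j _.
  by rewrite !mxE horner_exp exprMn mulrC exprVn.
by rewrite [d.[t] ^+ ek * d.[t] ^+ e]mulrC -mulf_div divff ?mulr1.
Qed.

Lemma eval3_fixed_s F m (d : {poly R}) q s : exists (n : {poly R}) (e : nat),
  forall t, d.[t] != 0 ->
    eval3 F (d.[t]^-1 *: eval_vec m t + s *: eval_vec q t) = n.[t] / d.[t] ^+ e.
Proof.
(* $m/d+sq=(m+sdq)/d$. *)
have [n [e nE]] := eval3_frac F (m + (s *: d) *: q) d.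
exists n, e => t dt; rewrite -nE//; congr (eval3 F _).
apply/matrixP => j k; rewrite !mxE hornerD hornerM hornerZ.
by rewrite mulrDr; congr (_ + _); rewrite mulrA mulrCA mulVf// mulr1.
Qed.

Lemma eval3_line F (u v : 'cV[R]_3) :
  exists n : {poly R}, forall s, eval3 F (u + s *: v) = n.[s].
Proof.
have [n [e nE]] := eval3_frac F (\col_j ((u j 0)%:P + v j 0 *: 'X)) 1.
exists n => s; have := nE s; rewrite hornerC expr1n oner_neq0 divr1 => <- //.
congr (eval3 F _); apply/matrixP => j k; rewrite !mxE ord1 hornerD hornerC.
by rewrite hornerZ hornerX invr1 mul1r mulrC.
Qed.

Lemma surface_nonvanishing p q F y :
  ruled_surface p q y -> eval3 F y != 0 ->
  exists t s x, ruled_point p q t s x /\ eval3 F x != 0.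
Proof.
move=> Sy Fy; apply: contrapT => no; move/eqP: Fy; apply; apply: Sy => x [t [s pt]].
by apply/eqP/negP => Fx; apply: no; exists t, s, x; split=> //; apply/negP.
Qed.

(** [F] is nonzero at some $x(t_0,s_0)$. Along $s=s_0$ it is then a nonzero rational function of
    [t], so on all but finitely many rulings it restricts to a nonzero polynomial in [s]. *)
Lemma finite_vanishing_rulings p q F y :
  ruled_surface p q y -> eval3 F y != 0 ->
  exists2 E, finite_set E & forall t (u : 'cV[R]_3), ~ E t ->
    (forall j, ratfun_value (p j 0) t (u j 0)) ->
    finite_set [set s | eval3 F (u + s *: eval_vec q t) = 0].
Proof.
move=> Sy Fy; have [t0 [s0 [x0 [pt0 Fx0]]]] := surface_nonvanishing Sy Fy.
have [u0 u0v _] := pt0; have [m [d [dt0 pE]]] := frac_vec_regular_at u0v.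
have [n [e nE]] := eval3_fixed_s F m d q s0.
have n0 : n != 0.
  apply: contra_neq Fx0 => n0; move: pt0; rewrite pE.
  by move=> /(ruled_point_frac _ _ _ _ dt0) ->; rewrite nE// n0 horner0 mul0r.
exists ([set t | n.[t] = 0] `|` [set t | d.[t] = 0]).
  by rewrite finite_setU; split; apply: finite_roots => //; apply: horner_neq0 dt0.
move=> t u /not_orP[/= nt dt] uv; move/eqP: dt => dt.
have uE : u = d.[t]^-1 *: eval_vec m t.
  apply/matrixP => j k; rewrite ord1; apply: ratfun_value_uniq (uv j) _.
  by rewrite pE; apply: frac_vec_value.
have [g gE] := eval3_line F u (eval_vec q t).
have g0 : g != 0.
  apply: contra_not_neq nt => g0; move: (gE s0).
  rewrite uE nE// g0 horner0 => /eqP.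
  by rewrite mulf_eq0 invr_eq0 (negPf (expf_neq0 _ dt)) orbF => /eqP.
by apply: sub_finite_set (finite_roots g0) => s /= ; rewrite gE.
Qed.

(** If [F] were nonzero somewhere on the surface, some ruling outside [E] would meet its zero set in
    finitely many points only, although it lies inside that set. *)
Lemma ruled_surface_dense p q F E : finite_set E ->
  (forall t s x, ~ E t -> ruled_point p q t s x -> eval3 F x = 0) ->
  forall y, ruled_surface p q y -> eval3 F y = 0.
Proof.
move=> finE F0 y Sy; apply/eqP; apply/negP => /negP Fy.
have [E' finE' FE'] := finite_vanishing_rulings Sy Fy.
have [m [d [d0 pE]]] := frac_vecP p.
have [] : ([set: R] `\` (E `|` E' `|` [set t | d.[t] = 0])) !=set0.
  apply: infinite_setN0; apply: infinite_setD; first exact: infinite_numField.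
  by rewrite !finite_setU; do !split=> //; apply: finite_roots.
move=> t [_ /not_orP[/not_orP[Et E't] /eqP dt]].
have uv j : ratfun_value (p j 0) t ((d.[t]^-1 *: eval_vec m t) j 0).
  by rewrite pE; apply: frac_vec_value.
apply: (@infinite_numField R); apply: sub_finite_set (FE' t _ E't uv) => s _ /=.
by apply: (F0 t s) => //; exists (d.[t]^-1 *: eval_vec m t).
Qed.

Lemma ruled_surface_subset p q p' q' E : finite_set E ->
  (forall t, ~ E t -> exists t', ruling p q t `<=` ruling p' q' t') ->
  ruled_surface p q `<=` ruled_surface p' q'.
Proof.
move=> finE sub y Sy F F0; apply: ruled_surface_dense finE _ y Sy => t s x Et pt.
have [t' st'] := sub t Et; apply: F0.
by have [s' pt'] := st' x (ex_intro _ s pt); exists t', s'.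
Qed.

(* The first coordinate of the inverse of (p', q'), restricted to a generic
   curve [s = s0] of (p, q), reads off the parameter of each shared ruling. *)
Lemma ruling_correspondence p q p' q' : proper_param p' q' ->
  ruled_surface p q = ruled_surface p' q' ->
  exists (N D : {poly R}) E, finite_set E /\
    forall t t', ~ E t -> ruling p q t = ruling p' q' t' ->
      D.[t] != 0 /\ N.[t] / D.[t] = t'.
Proof.
move=> [a1 [b1 [a2 [b2 [[y1 Sy1 b1y1] [y2 Sy2 b2y2] inv _]]]]] SE.
rewrite -SE in Sy1 Sy2.
have [E1 finE1 b1E] := finite_vanishing_rulings Sy1 b1y1.
have [E2 finE2 b2E] := finite_vanishing_rulings Sy2 b2y2.
have [m [d [d0 pE]]] := frac_vecP p.
have [] : ([set: R] `\` (E1 `|` E2 `|` [set t | d.[t] = 0])) !=set0.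
  apply: infinite_setN0; apply: infinite_setD; first exact: infinite_numField.
  by rewrite !finite_setU; do !split=> //; apply: finite_roots.
move=> t0 [_ /not_orP[/not_orP[E1t E2t] /eqP dt0]].
have uv j : ratfun_value (p j 0) t0 ((d.[t0]^-1 *: eval_vec m t0) j 0).
  by rewrite pE; apply: frac_vec_value.
(* The value [s0] is chosen so that both denominators of the inverse are nonzero at $x(t_0,s_0)$;
   they are then nonzero rational functions along $s=s_0$. *)
have [] := infinite_setN0 (infinite_setD (infinite_setD (@infinite_numField R)
  (b1E _ _ E1t uv)) (b2E _ _ E2t uv)).
move=> s0 [[_ /= /eqP b1x0] /= /eqP b2x0].
have [na [ea naE]] := eval3_fixed_s a1 m d q s0.
have [nb [eb nbE]] := eval3_fixed_s b1 m d q s0.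
have [nc [ec ncE]] := eval3_fixed_s b2 m d q s0.
have nb0 : nb != 0.
  by apply: contra_neq b1x0 => nb0; rewrite nbE// nb0 horner0 mul0r.
have nc0 : nc != 0.
  by apply: contra_neq b2x0 => nc0; rewrite ncE// nc0 horner0 mul0r.
exists (na * d ^+ eb), (nb * d ^+ ea),
  ([set t | d.[t] = 0] `|` [set t | nb.[t] = 0] `|` [set t | nc.[t] = 0]).
split; first by rewrite !finite_setU; do !split; apply: finite_roots.
move=> t t' /not_orP[/not_orP[/eqP dt /eqP nbt] /eqP nct] rE.
rewrite !hornerM !horner_exp mulf_neq0 ?expf_neq0//; split=> //.
(* This point lies on the shared ruling, so it is also a point of [(p', q')] over [t'], and the
   inverse returns [t']. *)
pose x := d.[t]^-1 *: eval_vec m t + s0 *: eval_vec q t.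
have : ruling p q t x by exists s0; rewrite pE; apply/ruled_point_frac.
rewrite rE => -[s' pt'].
have [] := inv _ _ _ pt'.
- by rewrite nbE// mulf_neq0 ?invr_eq0 ?expf_neq0.
- by rewrite ncE// mulf_neq0 ?invr_eq0 ?expf_neq0.
move=> <- _; rewrite naE// nbE// invf_div mulf_div.
by rewrite [d.[t] ^+ ea * _]mulrC.
Qed.

(** The correspondences of parameters in the two directions are rational and mutually inverse on an
    infinite set. [E] holds parameters of the second family that later divisions must avoid. *)
Lemma shared_rulings_mobius p q p' q' E :
  proper_param p q -> proper_param p' q' ->
  ruled_surface p q = ruled_surface p' q' ->
  ~ doubly_ruled (ruled_surface p' q') -> finite_set E ->
  exists (alpha beta gamma delta : R) (T : set R),
    [/\ alpha * delta - beta * gamma != 0, infinite_set T & forall t, T t ->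
      let t' := (alpha * t + beta) / (gamma * t + delta) in
      [/\ gamma * t + delta != 0, ~ E t', ruling p q t !=set0 &
        ruling p q t = ruling p' q' t']].
Proof.
move=> prop prop' SE ndr finE.
have [N [D [E1 [finE1 ND]]]] := ruling_correspondence prop' SE.
have [U [V [E2 [finE2 UV]]]] := ruling_correspondence prop (esym SE).
have infI : infinite_set (rulings p q `&` rulings p' q').
  move=> fin; apply: ndr; exists (rulings p q), (rulings p' q').
  by split=> //; [exists p, q|exists p', q'].
(* Exceptional parameters on either side account for finitely many lines; removing these lines
   leaves infinitely many. *)
pose badL := ruling p q @` E1 `|` ruling p' q' @` (E2 `|` E).
have finL : finite_set badL.
  by rewrite finite_setU; split; apply: finite_image => //; rewrite finite_setU.
have infL := infinite_setD infI finL.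
pose pair t t' := [/\ ~ E1 t, ~ (E2 `|` E) t', ruling p q t !=set0 &
  ruling p q t = ruling p' q' t'].
pose T := [set t | exists t', pair t t'].
(* The image of [T] under [ruling p q] contains all remaining lines. *)
have infT : infinite_set T.
  move=> finT; apply: infL; apply: sub_finite_set (finite_image (ruling p q) finT).
  move=> L [[[L0 [t Lt]] [_ [t' Lt']]] goodL]; exists t; last exact: esym.
  exists t'; split.
  - by move=> E1t; apply: goodL; left; exists t.
  - by move=> Et'; apply: goodL; right; exists t'.
  - by rewrite -Lt.
  - by rewrite -Lt.
have invT t : T t -> [/\ D.[t] != 0, V.[N.[t] / D.[t]] != 0 &
    U.[N.[t] / D.[t]] / V.[N.[t] / D.[t]] = t].
  move=> [t' [E1t /not_orP[E2t' _] _ L]].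
  have [D0 ->] := ND _ _ E1t L; have [V0 UVt] := UV _ _ E2t' (esym L).
  by split.
have [alpha [beta [gamma [delta [det0 mobE]]]]] := birational_mobius infT invT.
exists alpha, beta, gamma, delta, T; split=> // t Tt t1.
have [lin0 NDE] := mobE t Tt; have [t' [E1t /not_orP[_ Et'] L0 L]] := Tt.
have [_ NDt'] := ND _ _ E1t L.
by rewrite /t1 -NDE NDt'; split.
Qed.

End RuledParametrizations.

(** * Ruled surfaces under affine maps *)

Section AffineImages.
Variable R : realType.
Local Open Scope classical_set_scope.
Implicit Types (p : 'cV[ratfun R]_3) (q : 'cV[{poly R}]_3) (F : {mpoly R[3]}).
Implicit Types (A : 'M[R]_3) (b : 'cV[R]_3).

Definition affine_base A b p := const_mat A *m p + const_mat b.
Definition affine_dir A q := map_mx polyC A *m q.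
(** The pullback of [F] along the affine map; it transports vanishing conditions and inverse
    parametrizations. *)
Definition affine_mpoly A b F : {mpoly R[3]} :=
  F \mPo [tuple (\sum_j A i j *: 'X_j + (b i 0)%:MP)%R | i < 3].

Lemma eval3_affine A b F x : eval3 (affine_mpoly A b F) x = eval3 F (A *m x + b).
Proof.
rewrite /eval3 comp_mpoly_meval; apply: meval_eq => i.
rewrite tnth_mktuple mevalD mevalC raddf_sum !mxE; congr (_ + _).
by apply: eq_bigr => j _; rewrite /= mevalZ mevalXU.
Qed.

Lemma eval_affine_dir A q t : eval_vec (affine_dir A q) t = A *m eval_vec q t.
Proof.
apply/matrixP => i k; rewrite !mxE horner_sum; apply: eq_bigr => j _.
by rewrite !mxE hornerM hornerC ord1.
Qed.

Lemma affine_base_value A b p t (u : 'cV[R]_3) :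
  (forall j, ratfun_value (p j 0) t (u j 0)) ->
  forall j, ratfun_value (affine_base A b p j 0) t ((A *m u + b) j 0).
Proof.
move=> uv j; rewrite !mxE; apply: ratfun_valueD; last exact: ratfun_value_const.
apply: ratfun_value_sum => i; rewrite mxE.
by apply: ratfun_valueM (uv i); apply: ratfun_value_const.
Qed.

(** The inverse is written in the form $Bx+c$, so that every statement about affine images applies
    to it as well. *)
Lemma affineK A b : \det A != 0 ->
  (forall x : 'cV[R]_3, invmx A *m (A *m x + b) + - (invmx A *m b) = x) /\
  (forall y : 'cV[R]_3, A *m (invmx A *m y + - (invmx A *m b)) + b = y).
Proof.
move=> A0; have Au : A \in unitmx by rewrite unitmxE unitfE.
split=> x; first by rewrite mulmxDr mulKmx// addrK.
by rewrite mulmxDr mulmxN !mulKVmx// subrK.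
Qed.

Lemma const_mat1 : const_mat 1%:M = 1%:M :> 'M[ratfun R]_3.
Proof. by rewrite /const_mat (map_mx1 (@tofrac _ \o polyC)). Qed.

Lemma const_matM m n k (M : 'M[R]_(m, n)) (N : 'M[R]_(n, k)) :
  const_mat (M *m N) = const_mat M *m const_mat N.
Proof. exact: (map_mxM (@tofrac _ \o polyC)). Qed.

Lemma const_matN m n (M : 'M[R]_(m, n)) : const_mat (- M) = - const_mat M.
Proof. exact: (map_mxN (@tofrac _ \o polyC)). Qed.

Lemma affine_baseK A b p : \det A != 0 ->
  affine_base (invmx A) (- (invmx A *m b)) (affine_base A b p) = p.
Proof.
move=> A0; have Au : A \in unitmx by rewrite unitmxE unitfE.
rewrite /affine_base const_matN const_matM mulmxDr addrK mulmxA -const_matM.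
by rewrite mulVmx// const_mat1 mul1mx.
Qed.

Lemma affine_dirK A q : \det A != 0 -> affine_dir (invmx A) (affine_dir A q) = q.
Proof.
move=> A0; have Au : A \in unitmx by rewrite unitmxE unitfE.
by rewrite /affine_dir mulmxA -map_mxM mulVmx// map_mx1 mul1mx.
Qed.

Lemma poly_vec_affine_dir A q :
  poly_vec (affine_dir A q) = const_mat A *m poly_vec q.
Proof. by rewrite /poly_vec (map_mxM (@tofrac _)) -map_mx_comp. Qed.

Lemma ruled_point_affine A b p q t s x : ruled_point p q t s x ->
  ruled_point (affine_base A b p) (affine_dir A q) t s (A *m x + b).
Proof.
move=> [u uv ->]; exists (A *m u + b); first exact: affine_base_value.
by rewrite eval_affine_dir mulmxDr -scalemxAr addrAC.
Qed.

Lemma ruled_surface_affine A b p q x : ruled_surface p q x ->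
  ruled_surface (affine_base A b p) (affine_dir A q) (A *m x + b).
Proof.
move=> Sx F F0; rewrite -eval3_affine; apply: Sx => y [t [s pt]].
by rewrite eval3_affine; apply: F0; exists t, s; apply: ruled_point_affine.
Qed.

(** The inclusion not given by the previous lemma is that same lemma for the inverse map. *)
Lemma ruled_surface_affineE A b p q : \det A != 0 ->
  ruled_surface (affine_base A b p) (affine_dir A q) =
  [set A *m x + b | x in ruled_surface p q].
Proof.
move=> A0; have [K K'] := affineK b A0.
apply/seteqP; split=> [y Sy|_ [x Sx <-]]; last exact: ruled_surface_affine.
exists (invmx A *m y + - (invmx A *m b)); last exact: K'.
rewrite -(affine_baseK b p A0) -(affine_dirK q A0).
exact: ruled_surface_affine.
Qed.

(** The rational inverse of the new parametrization is the old one composed with the inverse affine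
    map. *)
Lemma proper_param_affine A b p q : \det A != 0 -> proper_param p q ->
  proper_param (affine_base A b p) (affine_dir A q).
Proof.
move=> A0 [a1 [b1 [a2 [b2 [[y1 Sy1 b1y1] [y2 Sy2 b2y2] inv inv']]]]].
have [K K'] := affineK b A0; set B := invmx A in K K'; set c := - _ in K K'.
have pull t s y : ruled_point (affine_base A b p) (affine_dir A q) t s y ->
    ruled_point p q t s (B *m y + c).
  by move=> /(ruled_point_affine B c); rewrite affine_baseK// affine_dirK.
exists (affine_mpoly B c a1), (affine_mpoly B c b1),
       (affine_mpoly B c a2), (affine_mpoly B c b2); split.
- exists (A *m y1 + b); first exact: ruled_surface_affine.
  by rewrite eval3_affine K.
- exists (A *m y2 + b); first exact: ruled_surface_affine.
  by rewrite eval3_affine K.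
- by move=> t s y /pull pt; rewrite !eval3_affine; apply: inv pt.
- move=> y z; rewrite ruled_surface_affineE// !eval3_affine => -[x Sx <-].
  rewrite K => b1x b2x /pull pt; have := inv' _ _ Sx b1x b2x pt => <-.
  by rewrite K'.
Qed.

End AffineImages.

(** * Coprime direction vectors and coinciding rulings *)

Section DirectionVectors.
Variable R : realType.
Local Open Scope classical_set_scope.
Implicit Types (p : 'cV[ratfun R]_3) (q h : 'cV[{poly R}]_3).

(** Every partial gcd is a combination of the components; gcds are determined up to a unit, hence
    the scalars [k]. *)
Lemma coprime_vec_bezout q : coprime_vec q ->
  exists u : 'I_3 -> {poly R}, \sum_j u j * q j 0 = 1.
Proof.
rewrite /coprime_vec; set g := \big[_/_]_(j < 3) _.
have [u ->] : exists u : 'I_3 -> {poly R}, g = \sum_j u j * q j 0.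
  apply: (big_ind (fun g => exists u : 'I_3 -> {poly R}, g = \sum_j u j * q j 0)).
  - by exists (fun=> 0); rewrite big1// => j _; rewrite mul0r.
  - move=> _ _ [u ->] [v ->]; set x := \sum_j _; set y := \sum_j _.
    have [[a c] /=] := Bezoutp x y; rewrite eqp_sym => /eqpf_eq[k _ ->].
    exists (fun j => k *: (a * u j + c * v j)).
    rewrite /x /y !mulr_sumr -big_split scaler_sumr; apply: eq_bigr => j _ /=.
    by rewrite -scalerAl mulrDl !mulrA.
  - move=> j _; exists (fun i => (i == j)%:R); rewrite (bigD1 j)//= eqxx mul1r.
    by rewrite big1 ?addr0// => i /negPf ->; rewrite mul0r.
rewrite eqp_sym => /eqpf_eq[k _ ->]; exists (fun j => k *: u j).
by rewrite scaler_sumr; apply: eq_bigr => j _; rewrite scalerAl.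
Qed.

Lemma coprime_vec_neq0 q : coprime_vec q -> exists j, q j 0 != 0.
Proof.
move=> /coprime_vec_bezout[u uq]; apply: contrapT => no.
have /eqP[] := oner_neq0 {poly R}; rewrite -uq big1// => j _.
by apply/eqP/negP => /negP; rewrite mulf_eq0 negb_or => /andP[_ qj]; apply: no; exists j.
Qed.

Lemma size_linear_poly (a b : R) : (size (a *: 'X + b%:P : {poly R})%R <= 2)%N.
Proof.
rewrite (leq_trans (size_polyD _ _))// geq_max.
rewrite (leq_trans (size_scale_leq _ _)) ?size_polyX//.
by rewrite (leq_trans (size_polyC_leq1 _)).
Qed.

Lemma coprime_vec_size q n : coprime_vec q -> degree_vec q = n ->
  exists j, size (q j 0) = n.+1.
Proof.
move=> cq <-; rewrite /degree_vec.
have [|j jE] := @bigop.eq_bigmax 'I_3 (fun j => (size (q j 0%R)).-1).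
  by rewrite card_ord.
(* A zero component can attain the maximum, since its truncated degree is 0. In that case every
   nonzero component is a constant, of size 1. *)
have [q0|q0] := eqVneq (q j 0) 0; last first.
  by exists j; rewrite jE prednK// size_poly_gt0.
have [i qi0] := coprime_vec_neq0 cq; exists i.
have := leq_bigmax (F := fun j : 'I_3 => (size (q j 0%R)).-1) i.
rewrite jE q0 size_poly0 leqn0 => /eqP si.
have s0 : (0 < size (q i 0%R))%N by rewrite size_poly_gt0.
by rewrite -(prednK s0) si.
Qed.

Lemma size_degree_vec q j : (size (q j 0%R) <= (degree_vec q).+1)%N.
Proof.
apply: leq_trans (leqSpred _) _.
exact: (leq_bigmax (F := fun j : 'I_3 => (size (q j 0%R)).-1) j).
Qed.

(** Multiplying $h_i$ by $\sum_j u_jq_j=1$ and exchanging indices gives $c=\sum_j u_jh_j$, a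
    polynomial. *)
Lemma coprime_vec_parallel q h : coprime_vec q ->
  (forall i j, h i 0 * q j 0 = q i 0 * h j 0) ->
  exists c, forall i, h i 0 = c * q i 0.
Proof.
move=> /coprime_vec_bezout[u uq] hq; exists (\sum_j u j * h j 0) => i.
rewrite -[LHS]mul1r -uq !mulr_suml; apply: eq_bigr => j _.
by rewrite -!mulrA; congr (_ * _); rewrite hq.
Qed.

(** The points $s=0$ and $s=1$ of the first line are read in the second parametrization; their
    difference compares the directions. *)
Lemma equal_rulings p q p' q' t t' :
  ruling p q t !=set0 -> ruling p q t = ruling p' q' t' ->
  exists (u v : 'cV[R]_3) (s r : R),
  [/\ forall j, ratfun_value (p j 0) t (u j 0),
      forall j, ratfun_value (p' j 0) t' (v j 0),
      u = v + s *: eval_vec q' t' & eval_vec q t = r *: eval_vec q' t'].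
Proof.
move=> [y [s0 [u uv _]]] rE.
have [s1 [v vv u1]] : ruling p' q' t' u.
  by rewrite -rE; exists 0, u => //; rewrite scale0r addr0.
have [s2 [v' vv' u2]] : ruling p' q' t' (u + eval_vec q t).
  by rewrite -rE; exists 1, u => //; rewrite scale1r.
have v'E : v' = v.
  by apply/matrixP => j k; rewrite ord1; apply: ratfun_value_uniq (vv' j) (vv j).
exists u, v, s1, (s2 - s1); split=> //.
apply: (addrI u); rewrite u2 v'E {1}u1 scalerBl -addrA; congr (_ + _).
by rewrite addrC subrK.
Qed.

Lemma vec_comp_value p alpha beta gamma delta t (v : 'cV[R]_3) :
  alpha * delta - beta * gamma != 0 -> gamma * t + delta != 0 ->
  (forall j, ratfun_value (p j 0)
     ((alpha * t + beta) / (gamma * t + delta)) (v j 0)) ->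
  forall j, ratfun_value (vec_comp p (mobius alpha beta gamma delta) j 0) t (v j 0).
Proof. by move=> det0 t0 pv j; rewrite mxE; apply: mobius_comp_value. Qed.

Lemma poly_vec_value q t j : ratfun_value (poly_vec q j 0) t (eval_vec q t j 0).
Proof. by rewrite !mxE; apply: ratfun_value_poly. Qed.

End DirectionVectors.

(** * The two equations derived from equality of the surfaces *)

Section AffineEquivalences.
Variables (R : realType) (n : nat) (p1 p2 : 'cV[ratfun R]_3).
Variables (q1 q2 : 'cV[{poly R}]_3) (A : 'M[R]_3) (b : 'cV[R]_3).
Hypothesis A0 : \det A != 0.
Local Open Scope classical_set_scope.

Let P := affine_base A b p1.
Let Q := affine_dir A q1.

Section FromSurfaces.
Variables (alpha beta gamma delta : R) (T : set R) (i0 : 'I_3).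
Hypothesis cop1 : coprime_vec q1.
Hypothesis deg1 : degree_vec q1 = n.
Hypothesis deg2 : degree_vec q2 = n.
Hypothesis det0 : alpha * delta - beta * gamma != 0.
Hypothesis infT : infinite_set T.
Let w t := (alpha * t + beta) / (gamma * t + delta).
Hypothesis TP : forall t, T t ->
  [/\ gamma * t + delta != 0, (q2 i0 0).[w t] != 0, ruling P Q t !=set0 &
      ruling P Q t = ruling p2 q2 (w t)].
Let N : {poly R} := alpha *: 'X + beta%:P.
Let D : {poly R} := gamma *: 'X + delta%:P.
(** The vector $(\gamma t+\delta)^n q_2(\psi(t))$, polynomial because [q2] has degree [n]. *)
Let H : 'cV[{poly R}]_3 := \col_j homogenize n (q2 j 0) N D.

Let ND t : N.[t] = alpha * t + beta /\ D.[t] = gamma * t + delta.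
Proof. by rewrite !hornerE. Qed.

Let evalH t : T t -> eval_vec H t = (gamma * t + delta) ^+ n *: eval_vec q2 (w t).
Proof.
move=> /TP[t0 _ _ _]; have [NE DE] := ND t.
apply/matrixP => j k; rewrite !mxE horner_homogenize_div ?NE ?DE ?ord1//.
by rewrite -deg2 size_degree_vec.
Qed.

(** $h=A^{-1}H$ is parallel to [q1] at infinitely many parameters, so $h=c\,q_1$ with [c] polynomial
    by coprimality, and comparing degrees makes [c] constant. *)
Lemma direction_proportional : exists2 k : R, k != 0 & Q = k%:P *: H.
Proof.
pose h := affine_dir (invmx A) H.
have AinvK : affine_dir A h = H.
  have B0 : \det (invmx A) != 0 by rewrite det_inv invr_eq0.
  by have := affine_dirK H B0; rewrite invmxK.
have [t0 Tt0] := infinite_setN0 infT.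
have [c cE] : exists c, forall i, h i 0 = c * q1 i 0.
  apply: coprime_vec_parallel => // i j; apply: (poly_eq_infinite infT) => t Tt.
  have [_ _ L0 L] := TP Tt; have [u [v [s [r [_ _ _ QE]]]]] := equal_rulings L0 L.
  have hE : eval_vec h t = (gamma * t + delta) ^+ n *: (invmx A *m eval_vec q2 (w t)).
    by rewrite eval_affine_dir evalH// scalemxAr.
  have q1E : eval_vec q1 t = r *: (invmx A *m eval_vec q2 (w t)).
    by rewrite -(affine_dirK q1 A0) eval_affine_dir QE scalemxAr.
  have entry (X : 'cV[{poly R}]_3) k : (X k 0).[t] = eval_vec X t k 0 by rewrite mxE.
  rewrite !hornerM !entry hE q1E; move: (invmx A *m _) => z.
  by rewrite !mxE; ring.
have hcq : h = c *: q1 by apply/matrixP => j k; rewrite ord1 cE mxE.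
have H0 : H != 0.
  apply/eqP => H0; have [lin0 q20 _ _] := TP Tt0.
  have := congr1 (fun X : 'cV[R]_3 => X i0 0) (evalH Tt0).
  rewrite H0 !mxE horner0 => /esym/eqP.
  by rewrite mulf_eq0 (negPf q20) orbF (negPf (expf_neq0 _ lin0)).
have c0 : c != 0.
  by apply: contra_neq H0 => c0; rewrite -AinvK hcq c0 scale0r /affine_dir mulmx0.
(* A component of [q1] of exact degree [n]; the same component of [h] has degree at most [n]. *)
have [j sj] := coprime_vec_size cop1 deg1.
have size_h : (size (h j 0%R) <= n.+1)%N.
  rewrite mxE; apply: leq_trans (size_sum _ _ _) _; apply/bigmax_leqP => i _.
  rewrite !mxE mul_polyC; apply: leq_trans (size_scale_leq _ _) _.
  rewrite -[n in (_ <= n.+1)%N]mul1n; apply: size_homogenize.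
    exact: size_linear_poly.
  exact: size_linear_poly.
have /size_poly1P[k k0 cE'] : size c == 1%N.
  move: size_h; rewrite cE size_mul// -?size_poly_gt0 ?sj// addnS /=.
  rewrite -[leqRHS]add1n leq_add2r => sc.
  by rewrite eqn_leq sc size_poly_gt0.
(* $A^{-1}H=k\,q_1$ is solved for $A\,q_1$. *)
exists k^-1; first by rewrite invr_eq0.
rewrite -AinvK hcq cE' /affine_dir -scalemxAr scalerA -polyCM mulVf//.
by rewrite scale1r.
Qed.

Let psi := mobius alpha beta gamma delta.

Lemma direction_equation : exists2 k : R, k != 0 &
  poly_vec Q = (const_ratfun k * poly_ratfun D ^+ n) *: vec_comp (poly_vec q2) psi.
Proof.
have [k k0 QE] := direction_proportional; exists k => //.
apply/matrixP => j l; rewrite [l]ord1; apply: (ratfun_eq_infinite infT) => t Tt.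
have [t0 _ _ _] := TP Tt; exists (eval_vec Q t j 0).
split; first exact: poly_vec_value.
have -> : eval_vec Q t j 0 = k * (gamma * t + delta) ^+ n * eval_vec q2 (w t) j 0.
  have -> : eval_vec Q t = k *: eval_vec H t.
    by apply/matrixP => i l'; rewrite QE !mxE hornerM hornerC.
  by rewrite evalH// scalerA mxE.
rewrite mxE; apply: ratfun_valueM.
  apply: ratfun_valueM; first exact: ratfun_value_const.
  by apply: ratfun_valueX; have [_ <-] := ND t; apply: ratfun_value_poly.
by apply: vec_comp_value => // i; apply: poly_vec_value.
Qed.

(** [c] is solved from the coordinate [i0], in which [q2] is nonzero at every matched parameter. The
    other coordinates follow, as the base points differ by a multiple of the direction. *)
Lemma base_equation : exists c : ratfun R,
  P = vec_comp p2 psi + c *: vec_comp (poly_vec q2) psi.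
Proof.
exists ((P i0 0 - vec_comp p2 psi i0 0) / vec_comp (poly_vec q2) psi i0 0).
apply/matrixP => j l; rewrite [l]ord1; apply: (ratfun_eq_infinite infT) => t Tt.
have [t0 q20 L0 L] := TP Tt.
have [u [v [s [r [uv vv uE _]]]]] := equal_rulings L0 L.
exists (u j 0); split=> //.
have p2v : forall i, ratfun_value (vec_comp p2 psi i 0) t (v i 0).
  exact: vec_comp_value.
have q2v : forall i, ratfun_value (vec_comp (poly_vec q2) psi i 0) t
    (eval_vec q2 (w t) i 0).
  by apply: vec_comp_value => // i; apply: poly_vec_value.
have q2i0 : eval_vec q2 (w t) i0 0 != 0 by rewrite mxE.
have -> : u j 0 = v j 0 +
    (u i0 0 - v i0 0) / eval_vec q2 (w t) i0 0 * eval_vec q2 (w t) j 0.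
  move: (eval_vec q2 (w t)) q2i0 uE => z z0 ->.
  by rewrite !mxE [v i0 0 + _]addrC addrK mulfK.
rewrite mxE; apply: ratfun_valueD; first exact: p2v.
rewrite mxE; apply: ratfun_valueM; last exact: q2v.
by apply: ratfun_value_div => //; apply: ratfun_valueB.
Qed.

End FromSurfaces.

(** * Equality of the surfaces derived from the two equations *)

Section FromEquations.
Variables (k alpha beta gamma delta : R) (c : ratfun R).
Hypothesis k0 : k != 0.
Hypothesis det0 : alpha * delta - beta * gamma != 0.
Let psi := mobius alpha beta gamma delta.
Let w t := (alpha * t + beta) / (gamma * t + delta).
Let winv t := (delta * t - beta) / (alpha - gamma * t).
Hypothesis dirE : poly_vec Q =
  (const_ratfun k * poly_ratfun (gamma *: 'X + delta%:P) ^+ n)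
    *: vec_comp (poly_vec q2) psi.
Hypothesis baseE : P = vec_comp p2 psi + c *: vec_comp (poly_vec q2) psi.

(** Over a fixed [t] the equations match the line parameters by $s\mapsto r+se$, a bijection since
    $e\neq0$. The exceptions are the pole of $\psi$ and the zeros of the denominators of [c] and of
    $p_2\circ\psi$. *)
Lemma equations_rulings : exists2 E : set R, finite_set E & forall t, ~ E t ->
  gamma * t + delta != 0 /\ ruling P Q t = ruling p2 q2 (w t).
Proof.
have [m2 [d2 [d20 p2E]]] := frac_vecP p2.
have [nc [dc [dc0 cE]]] := ratfun_frac c.
exists ([set t | gamma * t + delta = 0] `|` [set t | dc.[t] = 0] `|`
        winv @` [set t | d2.[t] = 0]).
  rewrite !finite_setU; do !split; first exact: finite_linear_roots det0.
    exact: finite_roots.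
  exact/finite_image/finite_roots.
move=> t /not_orP[/not_orP[/= /eqP t0 /eqP dct] d2t]; split=> //.
have {}d2t : d2.[w t] != 0.
  apply/eqP => d2w; apply: d2t; exists (w t) => //.
  exact: mobiusK.
have [v vv] : exists v : 'cV[R]_3, forall j, ratfun_value (p2 j 0) (w t) (v j 0).
  by exists (d2.[w t]^-1 *: eval_vec m2 (w t)) => j; rewrite p2E; apply: frac_vec_value.
pose r := nc.[t] / dc.[t].
have cr : ratfun_value c t r by rewrite cE; apply: ratfun_value_frac.
have q2v : forall i, ratfun_value (vec_comp (poly_vec q2) psi i 0) t
    (eval_vec q2 (w t) i 0).
  by apply: vec_comp_value => // i; apply: poly_vec_value.
pose e := k * (gamma * t + delta) ^+ n.
have e0 : e != 0 by rewrite mulf_neq0 ?expf_neq0.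
have QE : eval_vec Q t = e *: eval_vec q2 (w t).
  apply/matrixP => j l; rewrite [l]ord1.
  apply: ratfun_value_uniq (poly_vec_value Q t j) _.
  rewrite dirE mxE [X in ratfun_value _ _ X]mxE; apply: ratfun_valueM (q2v j).
  apply: ratfun_valueM; first exact: ratfun_value_const.
  apply: ratfun_valueX; have := ratfun_value_poly (gamma *: 'X + delta%:P) t.
  by rewrite !hornerE.
have Pv j : ratfun_value (P j 0) t ((v + r *: eval_vec q2 (w t)) j 0).
  rewrite baseE !mxE; apply: ratfun_valueD.
    by have := vec_comp_value det0 t0 vv j; rewrite mxE.
  by apply: ratfun_valueM => //; have := q2v j; rewrite !mxE.
apply/seteqP; split=> [y [s [u uv ->]]|y [s [v' v'v ->]]].
  exists (r + s * e), v => //.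
  have -> : u = v + r *: eval_vec q2 (w t).
    by apply/matrixP => j l; rewrite [l]ord1; apply: ratfun_value_uniq (Pv j).
  by rewrite QE scalerA -addrA -scalerDl.
have -> : v' = v.
  by apply/matrixP => j l; rewrite [l]ord1; apply: ratfun_value_uniq (vv j).
exists ((s - r) / e), (v + r *: eval_vec q2 (w t)) => //.
by rewrite QE scalerA divfK// -addrA -scalerDl [r + _]addrC subrK.
Qed.

(** Both inclusions follow from density. In the second, a parameter is written as
    $\psi(\psi^{-1}(t))$, so the pole of $\psi^{-1}$ and the $\psi$-image of [E] are excluded. *)
Lemma equations_surface : ruled_surface P Q = ruled_surface p2 q2.
Proof.
have [E finE rE] := equations_rulings; apply/seteqP; split.
  apply: (ruled_surface_subset finE) => t /rE[_ rt]; exists (w t).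
  by rewrite rt.
have fin0 : finite_set [set t | - gamma * t + alpha = 0].
  (* The inverse transformation has matrix rows $(\delta,-\beta)$ and $(-\gamma,\alpha)$, with the
     same determinant. *)
  apply: (@finite_linear_roots _ delta (- beta)).
  by rewrite mulrNN mulrC.
apply: (@ruled_surface_subset _ _ _ _ _
  ([set t | - gamma * t + alpha = 0] `|` w @` E)).
  by rewrite finite_setU; split=> //; apply: finite_image.
move=> t /not_orP[/= /eqP t0 wE]; exists (winv t).
have t0' : alpha - gamma * t != 0 by rewrite addrC -mulNr.
have [_ wK] := mobius_invK det0 t0'.
have [|_ ->] := rE (winv t); first by move=> Et; apply: wE; exists (winv t).
by rewrite /w wK.
Qed.

End FromEquations.
End AffineEquivalences.

Theorem proposition9 (R : realType) (n : nat)
    (p1 p2 : 'cV[ratfun R]_3) (q1 q2 : 'cV[{poly R}]_3)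
    (proper1 : proper_param p1 q1) (proper2 : proper_param p2 q2)
    (ndr1 : ~ doubly_ruled (ruled_surface p1 q1))
    (ndr2 : ~ doubly_ruled (ruled_surface p2 q2))
    (ncyl1 : ~ cylindrical q1) (ncyl2 : ~ cylindrical q2)
    (coprime1 : coprime_vec q1) (coprime2 : coprime_vec q2)
    (deg1 : degree_vec q1 = n) (deg2 : degree_vec q2 = n)
    (A : 'M[R]_3) (b : 'cV[R]_3) :
  affine_equivalence A b (ruled_surface p1 q1) (ruled_surface p2 q2) <->
  \det A != 0 /\
  exists (k alpha beta gamma delta : R) (c : ratfun R),
    let psi := mobius alpha beta gamma delta in
    [/\ k != 0,
        alpha * delta - beta * gamma != 0,
        const_mat A *m poly_vec q1 =
          (const_ratfun k * poly_ratfun (gamma *: 'X + delta%:P) ^+ n)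
            *: vec_comp (poly_vec q2) psi
      & const_mat A *m p1 + const_mat b =
          vec_comp p2 psi + c *: vec_comp (poly_vec q2) psi].
Proof.
have directions : const_mat A *m poly_vec q1 = poly_vec (affine_dir A q1).
  by rewrite poly_vec_affine_dir.
rewrite /affine_equivalence directions; split=> -[A0 H]; split=> //.
- have prop := proper_param_affine b A0 proper1.
  have SE : ruled_surface (affine_base A b p1) (affine_dir A q1) =
      ruled_surface p2 q2 by rewrite ruled_surface_affineE.
  (* The zeros of this component are kept out of the matched parameters, which allows [c] to be
     solved for. *)
  have [i0 qi0] := coprime_vec_neq0 coprime2.
  have [alpha [beta [gamma [delta [T [det0 infT TP]]]]]] :=
    shared_rulings_mobius prop proper2 SE ndr2 (finite_roots qi0).
  have TP' t (Tt : T t) := let: And4 t0 qt L0 L := TP t Tt in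
    And4 t0 (introT negP (fun q0 => qt (elimT eqP q0))) L0 L.
  have [k k0 dirE] := direction_equation A0 coprime1 deg1 deg2 det0 infT TP'.
  have [c baseE] := base_equation det0 infT TP'.
  by exists k, alpha, beta, gamma, delta, c.
- have [k [alpha [beta [gamma [delta [c [k0 det0 dirE baseE]]]]]]] := H.
  (* The affine image is the surface of the transported parametrization, so two ruled surfaces
     remain to be compared. *)
  rewrite -ruled_surface_affineE//.
  exact: equations_surface k0 det0 dirE baseE.
Qed.
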